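(* Let $n\geqslant 1$ be an integer, $X=\{1,\ldots,n\}$, and let $I$ be a nontrivial real interval, possibly unbounded, such that $[0,1]\subseteq I\subseteq \mathbb{R}_+$ or $[-1,1]\subseteq I$. Then a function $f\colon I^n\to\mathbb{R}$ is a signed Choquet integral if and only if the following three conditions hold: (i) $f$ is comonotonically modular. (ii) $f(\mathbf{0})=0$ and $f(x\mathbf{1}_S)=\mathrm{sign}(x)\,x\,f(\mathrm{sign}(x)\,\mathbf{1}_S)$ for all $x\in I$ and all $S\subseteq X$. (iii) If $[-1,1]\subseteq I$, then $f(\mathbf{1}_{X\setminus S})=f(\mathbf{1})+f(-\mathbf{1}_S)$ for all $S\subseteq X$.
   Context: Notation: $\mathbb{R}_+=[0,+\infty[$. ''Nontrivial'' means of positive Lebesgue measure. $\mathfrak{S}_X$ is the set of permutations of $X=\{1,\ldots,n\}$. For $\sigma\in\mathfrak{S}_X$, $\mathbb{R}^n_\sigma=\{\mathbf{x}=(x_1,\ldots,x_n)\in\mathbb{R}^n : x_{\sigma(1)}\leqslant\cdots\leqslant x_{\sigma(n)}\}$ and $I^n_\sigma=I^n\cap\mathbb{R}^n_\sigma$. For $S\subseteq X$, $\mathbf{1}_S$ is the $n$-tuple whose $i$th component is $1$ if $i\in S$ and $0$ otherwise; $\mathbf{1}=\mathbf{1}_X$ and $\mathbf{0}=\mathbf{1}_{\varnothing}$. $\mathrm{sign}(x)$ is $1$, $0$, $-1$ according to whether $x>0$, $x=0$, $x<0$. For $i\in X$, $S_\sigma^{\uparrow}(i)=\{\sigma(i),\ldots,\sigma(n)\}$,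 and $S_\sigma^{\uparrow}(n+1)=\varnothing$. Signed Choquet integral: a signed capacity on $X$ is a set function $v\colon 2^X\to\mathbb{R}$ with $v(\varnothing)=0$. The signed Choquet integral with respect to $v$ is the (well-defined) function $C_v\colon\mathbb{R}^n\to\mathbb{R}$ given by $$C_v(\mathbf{x})=\sum_{i=1}^n x_{\sigma(i)}\big(v(S_\sigma^{\uparrow}(i))-v(S_\sigma^{\uparrow}(i+1))\big),\qquad \mathbf{x}\in\mathbb{R}^n_\sigma,\ \sigma\in\mathfrak{S}_X.$$ A function $f\colon I^n\to\mathbb{R}$ is said to be a signed Choquet integral if it is the restriction to $I^n$ of $C_v$ for some signed capacity $v$ on $X$. Comonotonic modularity: two $n$-tuples $\mathbf{x},\mathbf{x}'\in I^n$ are comonotonic if there exists $\sigma\in\mathfrak{S}_X$ such that $\mathbf{x},\mathbf{x}'\in I^n_\sigma$. A function $f\colon I^n\to\mathbb{R}$ is comonotonically modular if $f(\mathbf{x})+f(\mathbf{x}')=f(\mathbf{x}\wedge\mathbf{x}')+f(\mathbf{x}\vee\mathbf{x}')$ for all comonotonic $\mathbf{x},\mathbf{x}'\in I^n$, where $\wedge$ and $\vee$ are the componentwise minimum and maximum. *)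

(* Defs.v *)
From HB Require Import structures.
From mathcomp Require Import all_boot all_order all_algebra all_fingroup.
From mathcomp Require Import all_classical all_reals all_analysis.
Set Implicit Arguments.
Unset Strict Implicit.
Unset Printing Implicit Defensive.

Import Order.TTheory GRing.Theory Num.Theory.
Local Open Scope ring_scope.

(* The index set X = {1, ..., n} is 'I_n, numbered from 0, and R^n is 'rV[R]_n.
   A function on I^n is represented by a total function on R^n of which only
   the values on I^n are ever constrained. *)

Definition in_box (R : realType) (n : nat) (I : interval R) (x : 'rV[R]_n) :=
  [forall i, x ord0 i \in I].

Definition in_cone (R : realType) (n : nat) (s : 'S_n) (x : 'rV[R]_n) :=
  sorted <=%R [seq x ord0 (s i) | i : 'I_n].

Definition ind (R : realType) (n : nat) (S : {set 'I_n}) : 'rV[R]_n :=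
  \row_i (i \in S)%:R.
Arguments ind : clear implicits.
Arguments ind R {n} S.

Definition vmin (R : realType) (n : nat) (x y : 'rV[R]_n) : 'rV[R]_n :=
  \row_i Num.min (x ord0 i) (y ord0 i).

Definition vmax (R : realType) (n : nat) (x y : 'rV[R]_n) : 'rV[R]_n :=
  \row_i Num.max (x ord0 i) (y ord0 i).

(* {s k, ..., s (n - 1)}; empty for k = n. *)
Definition upset (n : nat) (s : 'S_n) (k : nat) : {set 'I_n} :=
  [set s j | j : 'I_n & (k <= j)%N].

Definition signed_capacity (R : realType) (n : nat) (v : {set 'I_n} -> R) :=
  v finset.set0 = 0.

Definition choquet_sum (R : realType) (n : nat) (v : {set 'I_n} -> R)
    (s : 'S_n) (x : 'rV[R]_n) : R :=
  \sum_(i < n) x ord0 (s i) * (v (upset s i) - v (upset s i.+1)).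

(* The permutation used is an arbitrary one that sorts x: one always exists
   (in_cone_exists) and the value does not depend on it (choquetE). *)
Definition choquet (R : realType) (n : nat) (v : {set 'I_n} -> R)
    (x : 'rV[R]_n) : R :=
  choquet_sum v (odflt 1%g [pick s | in_cone s x]) x.

Lemma in_coneP (R : realType) (n : nat) (s : 'S_n) (x : 'rV[R]_n) :
  reflect (forall i j : 'I_n, (i <= j)%N -> x ord0 (s i) <= x ord0 (s j))
          (in_cone s x).
Proof.
have sz : size [seq x ord0 (s i) | i : 'I_n] = n by rewrite size_map size_enum_ord.
have nthE (i : 'I_n) : nth 0 [seq x ord0 (s i) | i : 'I_n] i = x ord0 (s i).
  by rewrite (nth_map i) ?size_enum_ord // nth_ord_enum.
apply: (iffP idP) => [sx i j ij|sx].
  by rewrite -!nthE; apply: sorted_leq_nth => //; rewrite ?inE ?sz //;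
     exact: le_trans.
apply/(sortedP 0) => k; rewrite sz => kn.
have := sx (Ordinal (ltnW kn)) (Ordinal kn) (leqnSn k).
by rewrite -!nthE.
Qed.

Lemma in_cone_exists (R : realType) (n : nat) (x : 'rV[R]_n) :
  exists s : 'S_n, in_cone s x.
Proof.
pose r := [rel i j : 'I_n | x ord0 i <= x ord0 j].
have /tuple_permP[p pE] : perm_eq (sort r (enum 'I_n)) (ord_tuple n).
  by rewrite val_ord_tuple; apply/permPl/perm_sort.
exists p; rewrite /in_cone.
have -> : [seq x ord0 (p i) | i : 'I_n] =
          [seq x ord0 i | i <- sort r (enum 'I_n)].
  rewrite pE /= -map_comp; apply: eq_map => i /=.
  by rewrite tnth_ord_tuple.
rewrite sorted_map; apply: sort_sorted => i j; exact: le_total.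
Qed.

Lemma choquet_sum_indep (R : realType) (n : nat) (v : {set 'I_n} -> R)
    (s t : 'S_n) (x : 'rV[R]_n) :
  in_cone s x -> in_cone t x -> choquet_sum v s x = choquet_sum v t x.
Proof.
case: n v s t x => [|n] v s t x sx tx.
  by rewrite /choquet_sum !big_ord0.
have st (i : 'I_n.+1) : x ord0 (s i) = x ord0 (t i).
  have E : [seq x ord0 (s i) | i : 'I_n.+1] = [seq x ord0 (t i) | i : 'I_n.+1].
    apply: (@le_sorted_eq _ _) => //.
    have P (u : 'S_n.+1) :
        perm_eq [seq x ord0 (u i) | i : 'I_n.+1] [seq x ord0 i | i : 'I_n.+1].
      rewrite -[X in perm_eq X _]/(map _ (enum _)) (map_comp (x ord0) u).
      apply: perm_map; apply: uniq_perm; rewrite ?enum_uniq //.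
        by rewrite map_inj_uniq ?enum_uniq //; exact: perm_inj.
      move=> j; rewrite mem_enum; apply/mapP; exists (u^-1%g j).
        by rewrite mem_enum.
      by rewrite permKV.
    by apply: (perm_trans (P s)); rewrite perm_sym.
  have nthE (u : 'S_n.+1) :
      nth 0 [seq x ord0 (u j) | j : 'I_n.+1] i = x ord0 (u i).
    by rewrite (nth_map i) ?size_enum_ord // nth_ord_enum.
  by rewrite -!nthE E.
pose y k := x ord0 (s (inord k)).
have abel (u : 'S_n.+1) : (forall i, x ord0 (u i) = x ord0 (s i)) ->
    choquet_sum v u x = y 0%N * v (upset u 0) - y n * v (upset u n.+1)
      + \sum_(i < n) (y i.+1 - y i) * v (upset u i.+1).
  move=> ux; rewrite /choquet_sum.
  under eq_bigr => i _ do rewrite ux mulrBr.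
  rewrite sumrB big_ord_recl [X in _ - X]big_ord_recr /=.
  under [in RHS]eq_bigr => i _ do rewrite mulrBl.
  rewrite sumrB.
  have -> : x ord0 (s ord0) = y 0%N by rewrite /y; congr (x _ (s _)); apply/val_inj; rewrite /= inordK.
  have -> : x ord0 (s ord_max) = y n by rewrite /y; congr (x _ (s _)); apply/val_inj; rewrite /= inordK.
  have -> : \sum_(i < n) x ord0 (s (lift ord0 i)) * v (upset u (bump 0 i))
          = \sum_(i < n) y i.+1 * v (upset u i.+1).
    apply: eq_bigr => i _; rewrite /y; congr (x _ (s _) * _).
    by apply/val_inj; rewrite /= inordK // ltnS.
  have -> : \sum_(i < n) x ord0 (s (widen_ord (leqnSn n) i)) * v (upset u i.+1)
          = \sum_(i < n) y i * v (upset u i.+1).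
    apply: eq_bigr => i _; rewrite /y; congr (x _ (s _) * _).
    by apply/val_inj; rewrite /= inordK // ltnS ltnW.
  by rewrite opprD [RHS]addrACA [X in _ = _ + X]addrC -!addrA;
     congr (_ + _); rewrite addrCA; congr (_ + _); rewrite addrC.
rewrite (abel s) // (abel t); last by move=> i; rewrite st.
have U0 (u : 'S_n.+1) : upset u 0 = finset.setT.
  apply/setP => j; rewrite finset.inE; apply/imsetP; exists (u^-1%g j) => //.
  by rewrite permKV.
have Un (u : 'S_n.+1) : upset u n.+1 = finset.set0.
  apply/setP => j; rewrite finset.inE; apply/negbTE/imsetP => -[k].
  by rewrite finset.inE leqNgt ltn_ord.
rewrite !U0 !Un; congr (_ + _); apply: eq_bigr => i _.
have [->|yneq] := eqVneq (y i.+1) (y i); first by rewrite subrr !mul0r.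
congr (_ * v _).
have upE (u : 'S_n.+1) : in_cone u x -> (forall k, x ord0 (u k) = x ord0 (s k)) ->
    upset u i.+1 = [set j | y i.+1 <= x ord0 j].
  move=> /in_coneP ucone ux; apply/setP => j; rewrite finset.inE.
  have iS : (inord i.+1 : 'I_n.+1) = i.+1 :> nat by rewrite inordK // ltnS.
  have iE : (inord i : 'I_n.+1) = i :> nat by rewrite inordK // ltnS ltnW.
  apply/imsetP/idP => [[k]|le_yj].
    by rewrite finset.inE => ik ->; rewrite /y -ux; apply: ucone; rewrite iS.
  exists (u^-1%g j); last by rewrite permKV.
  rewrite finset.inE ltnNge; apply/negP => le_ji.
  have le1 : x ord0 j <= y i.
    by rewrite -{1}(permKV u j) /y -ux; apply: ucone; rewrite iE.
  have le2 : y i <= y i.+1.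
    by rewrite /y -!ux; apply: ucone; rewrite iE iS.
  by move/eqP: yneq; apply; apply/le_anti; rewrite le2 (le_trans le_yj le1).
by rewrite (upE s) // (upE t).
Qed.

Lemma choquetE (R : realType) (n : nat) (v : {set 'I_n} -> R)
    (s : 'S_n) (x : 'rV[R]_n) :
  in_cone s x -> choquet v x = choquet_sum v s x.
Proof.
move=> sx; rewrite /choquet; case: pickP => [t tx|/(_ s)]; last by rewrite sx.
exact: choquet_sum_indep.
Qed.

Definition is_signed_choquet (R : realType) (n : nat) (I : interval R)
    (f : 'rV[R]_n -> R) : Prop :=
  exists v : {set 'I_n} -> R,
    signed_capacity v /\ forall x, in_box I x -> f x = choquet v x.

Definition comonotonic (R : realType) (n : nat) (I : interval R)
    (x x' : 'rV[R]_n) : Prop :=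
  exists s : 'S_n,
    (in_box I x && in_cone s x) /\ (in_box I x' && in_cone s x').

Definition comonotonically_modular (R : realType) (n : nat) (I : interval R)
    (f : 'rV[R]_n -> R) : Prop :=
  forall x x', comonotonic I x x' -> f x + f x' = f (vmin x x') + f (vmax x x').

(* Main.v *)
Require Import Defs.
From HB Require Import structures.
From mathcomp Require Import all_boot all_order all_algebra all_fingroup.
From mathcomp Require Import all_classical all_reals all_analysis.
Import Order.TTheory GRing.Theory Num.Theory.
Local Open Scope ring_scope.

(** On a fixed cone [C_v] is linear, which gives the direct implication.
    Conversely, put [v S = f 1_S].  Modularity applied to [x] and [0] gives
    [f x = f (x \/ 0) + f (x /\ 0)], so one may assume that [x] has constant
    sign.  If [x >= 0] is sorted by [s], let [x^k] agree with [x] on the upset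
    [U_k] and vanish elsewhere: [x^k] and [x_(s k) 1_(U_(k+1))] are the join
    and the meet of the comonotonic tuples [x^(k+1)] and [x_(s k) 1_(U_k)], so
    [f x] telescopes to the Choquet sum by homogeneity.  If [x <= 0], the same
    works with meets and the complements of the upsets, condition (iii)
    translating the values [f (- 1_S)] into values of [v]. *)

Section Choquet.
Set Implicit Arguments.
Unset Strict Implicit.
Context {R : realType} {n : nat}.
Implicit Types (I : interval R) (s : 'S_n) (x y : 'rV[R]_n) (S : {set 'I_n}).
Implicit Types (v : {set 'I_n} -> R) (f : 'rV[R]_n -> R) (c : R).

(** * Truncated tuples and upsets *)

Definition restr S x : 'rV[R]_n := \row_i if i \in S then x ord0 i else 0.

Lemma scale_ind c S : c *: ind R S = restr S (const_mx c).
Proof. by apply/rowP => i; rewrite !mxE; case: ifP; rewrite ?mulr1 ?mulr0. Qed.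

Lemma restr0 x : restr finset.set0 x = 0.
Proof. by apply/rowP => i; rewrite !mxE finset.in_set0. Qed.

Lemma restrT x : restr [set: 'I_n] x = x.
Proof. by apply/rowP => i; rewrite !mxE finset.in_setT. Qed.

Lemma mem_upset s k (i : 'I_n) : (s i \in upset s k) = (k <= i)%N.
Proof. by rewrite mem_imset ?finset.inE //; exact: perm_inj. Qed.

Lemma upset0 s : upset s 0 = [set: 'I_n].
Proof. by apply/setP => i; rewrite -(permKV s i) mem_upset finset.in_setT. Qed.

Lemma upset_ge s : upset s n = finset.set0.
Proof.
apply/setP => i; rewrite -(permKV s i) mem_upset finset.in_set0.
by rewrite leqNgt ltn_ord.
Qed.

(** Coordinates are compared in the order given by [s], so that [mem_upset] turns membership in an
    upset into an inequality of ranks. *)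
Lemma row_permP s x y : (forall i, x ord0 (s i) = y ord0 (s i)) -> x = y.
Proof. by move=> xy; apply/rowP => i; rewrite -(permKV s i). Qed.

(** * Stability of cones and boxes *)

Lemma in_cone_const s c : in_cone s (const_mx c).
Proof. by apply/in_coneP => i j _; rewrite !mxE. Qed.

Lemma in_cone0 s : in_cone s (0 : 'rV[R]_n).
Proof. exact: in_cone_const. Qed.

Lemma in_coneD s x y : in_cone s x -> in_cone s y -> in_cone s (x + y).
Proof.
move=> /in_coneP sx /in_coneP sy; apply/in_coneP => i j ij.
by rewrite !mxE lerD ?sx ?sy.
Qed.

Lemma in_coneZ s c x : 0 <= c -> in_cone s x -> in_cone s (c *: x).
Proof.
move=> c0 /in_coneP sx; apply/in_coneP => i j ij.
by rewrite !mxE ler_wpM2l ?sx.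
Qed.

Lemma in_cone_vmin s x y : in_cone s x -> in_cone s y -> in_cone s (vmin x y).
Proof.
move=> /in_coneP sx /in_coneP sy; apply/in_coneP => i j ij.
by rewrite !mxE le_min !ge_min sx // sy // orbT.
Qed.

Lemma in_cone_vmax s x y : in_cone s x -> in_cone s y -> in_cone s (vmax x y).
Proof.
move=> /in_coneP sx /in_coneP sy; apply/in_coneP => i j ij.
by rewrite !mxE ge_max !le_max sx // sy // orbT.
Qed.

(** The entries replaced by 0 have the lowest ranks, and those that remain are nonnegative. *)
Lemma in_cone_restr_upset s k x : (forall i, 0 <= x ord0 i) ->
  in_cone s x -> in_cone s (restr (upset s k) x).
Proof.
move=> x0 /in_coneP sx; apply/in_coneP => i j ij.
rewrite !mxE !mem_upset; case: leqP => ki; last by case: ifP.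
by rewrite (leq_trans ki ij) sx.
Qed.

Lemma in_cone_restr_upsetC s k x : (forall i, x ord0 i <= 0) ->
  in_cone s x -> in_cone s (restr (~: upset s k) x).
Proof.
move=> x0 /in_coneP sx; apply/in_coneP => i j ij.
rewrite !mxE !finset.inE !mem_upset -!ltnNge.
case: (ltnP j k) => jk; last by case: ifP.
by rewrite (leq_ltn_trans ij jk) sx.
Qed.

Lemma in_box_const I c : c \in I -> in_box I (const_mx c : 'rV[R]_n).
Proof. by move=> cI; apply/forallP => i; rewrite mxE. Qed.

Lemma in_box_restr I S x : 0 \in I -> in_box I x -> in_box I (restr S x).
Proof.
by move=> I0 /forallP xI; apply/forallP => i; rewrite mxE; case: ifP.
Qed.

Lemma in_box_vmin I x y : in_box I x -> in_box I y -> in_box I (vmin x y).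
Proof.
by move=> /forallP xI /forallP yI; apply/forallP => i; rewrite mxE minEle; case: ifP.
Qed.

Lemma in_box_vmax I x y : in_box I x -> in_box I y -> in_box I (vmax x y).
Proof.
by move=> /forallP xI /forallP yI; apply/forallP => i; rewrite mxE maxEle; case: ifP.
Qed.

(** * Linearity of [C_v] on a cone and its consequences *)

Lemma vminD_max x y : vmin x y + vmax x y = x + y.
Proof. by apply/rowP => i; rewrite !mxE addr_min_max. Qed.

Lemma choquet_sumD v s x y :
  choquet_sum v s (x + y) = choquet_sum v s x + choquet_sum v s y.
Proof.
by rewrite /choquet_sum -big_split; apply: eq_bigr => i _; rewrite mxE mulrDl.
Qed.

Lemma choquet_sumZ v s c x : choquet_sum v s (c *: x) = c * choquet_sum v s x.
Proof. by rewrite mulr_sumr; apply: eq_bigr => i _; rewrite mxE mulrA. Qed.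

Lemma choquetD v s x y : in_cone s x -> in_cone s y ->
  choquet v (x + y) = choquet v x + choquet v y.
Proof.
by move=> sx sy; rewrite !(choquetE v (s := s)) ?in_coneD // choquet_sumD.
Qed.

Lemma choquetZ v c x : 0 <= c -> choquet v (c *: x) = c * choquet v x.
Proof.
move=> c0; have [s sx] := in_cone_exists x.
by rewrite !(choquetE v (s := s)) ?in_coneZ // choquet_sumZ.
Qed.

Lemma choquet0 v : choquet v 0 = 0.
Proof. by rewrite -(scale0r 0) choquetZ // mul0r. Qed.

(** Meet and join stay in the cone and add up to [x + y], so additivity on the cone suffices. *)
Lemma choquet_modular v s x y : in_cone s x -> in_cone s y ->
  choquet v x + choquet v y = choquet v (vmin x y) + choquet v (vmax x y).
Proof.
move=> sx sy; rewrite -(choquetD v sx sy) -vminD_max.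
by rewrite (choquetD _ (s := s)) ?in_cone_vmin ?in_cone_vmax.
Qed.

(** Only nonnegative scalars preserve the cone, hence the factorization of [c] as its absolute value
    times its sign. *)
Lemma choquet_sgr v x c :
  choquet v (c *: x) = Num.sg c * c * choquet v (Num.sg c *: x).
Proof.
by rewrite [in LHS](numEsg c) mulrC -scalerA choquetZ // normrEsg.
Qed.

(** The tuple [1_(X \ S)] is the sum of [1] and [- 1_S], and a constant tuple lies in every cone. *)
Lemma choquet_indC v S :
  choquet v (ind R (~: S)) =
    choquet v (ind R [set: 'I_n]) + choquet v (- ind R S).
Proof.
have [s sS] := in_cone_exists (- ind R S).
have indT : ind R [set: 'I_n] = const_mx 1.
  by apply/rowP => i; rewrite !mxE finset.in_setT.
rewrite -(choquetD v (s := s)) ?indT ?in_cone_const //; congr choquet.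
by apply/rowP => i; rewrite !mxE finset.inE; case: (_ \in _); rewrite ?subrr ?subr0.
Qed.

(** * Joins and meets of consecutive truncations *)

Lemma vmax_restr_upset s (k : 'I_n) x : (forall i, 0 <= x ord0 i) ->
  in_cone s x ->
  vmax (restr (upset s k.+1) x) (restr (upset s k) (const_mx (x ord0 (s k)))) =
    restr (upset s k) x.
Proof.
move=> x0 /in_coneP sx; apply: (@row_permP s) => i; rewrite !mxE !mem_upset.
case: (ltngtP k i) => ki; last by rewrite (val_inj ki) (max_idPr _).
  by rewrite (max_idPl _) // sx // ltnW.
by rewrite maxxx.
Qed.

Lemma vmin_restr_upset s (k : 'I_n) x : (forall i, 0 <= x ord0 i) ->
  in_cone s x ->
  vmin (restr (upset s k.+1) x) (restr (upset s k) (const_mx (x ord0 (s k)))) =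
    restr (upset s k.+1) (const_mx (x ord0 (s k))).
Proof.
move=> x0 /in_coneP sx; apply: (@row_permP s) => i; rewrite !mxE !mem_upset.
case: (ltngtP k i) => ki; last by rewrite (min_idPl _).
  by rewrite (min_idPr _) // sx // ltnW.
by rewrite minxx.
Qed.

(** Complements of upsets grow with [k], so the truncation at [k.+1] is now obtained from the one at
    [k]. *)
Lemma vmin_restr_upsetC s (k : 'I_n) x : (forall i, x ord0 i <= 0) ->
  in_cone s x ->
  vmin (restr (~: upset s k) x)
       (restr (~: upset s k.+1) (const_mx (x ord0 (s k)))) =
    restr (~: upset s k.+1) x.
Proof.
move=> x0 /in_coneP sx; apply: (@row_permP s) => i.
rewrite !mxE !finset.inE !mem_upset.
case: (ltngtP k i) => ki /=; last by rewrite (val_inj ki) (min_idPr _).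
  by rewrite minxx.
by rewrite (min_idPl _) // sx // ltnW.
Qed.

Lemma vmax_restr_upsetC s (k : 'I_n) x : (forall i, x ord0 i <= 0) ->
  in_cone s x ->
  vmax (restr (~: upset s k) x)
       (restr (~: upset s k.+1) (const_mx (x ord0 (s k)))) =
    restr (~: upset s k) (const_mx (x ord0 (s k))).
Proof.
move=> x0 /in_coneP sx; apply: (@row_permP s) => i.
rewrite !mxE !finset.inE !mem_upset.
case: (ltngtP k i) => ki /=; last by rewrite (max_idPl _).
  by rewrite maxxx.
by rewrite (max_idPr _) // sx // ltnW.
Qed.

(** * Recovering [f] on tuples of constant sign *)

Lemma modular_nneg_telescope I f s x : 0 \in I ->
  comonotonically_modular I f -> f 0 = 0 ->
  in_box I x -> in_cone s x -> (forall i, 0 <= x ord0 i) ->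
  f x = \sum_(k < n) (f (x ord0 (s k) *: ind R (upset s k))
                      - f (x ord0 (s k) *: ind R (upset s k.+1))).
Proof.
move=> I0 fm f0 xI sx x0.
pose g k := f (restr (upset s k) x).
(* The truncations go from [x] at rank 0 down to the zero tuple at rank [n], which accounts for the
   minus sign. *)
have -> : f x = - \sum_(k < n) (g k.+1 - g k).
  rewrite -(big_mkord predT (fun k => g k.+1 - g k)) telescope_sumr //.
  by rewrite /g upset0 upset_ge restr0 restrT f0 sub0r opprK.
rewrite -sumrN; apply: eq_bigr => k _; rewrite !scale_ind opprB /g.
have xkI : x ord0 (s k) \in I by move/forallP : xI.
have /fm : comonotonic I (restr (upset s k.+1) x)
    (restr (upset s k) (const_mx (x ord0 (s k)))).
  exists s; rewrite !in_box_restr ?in_box_const ?in_cone_restr_upset //.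
    by move=> i; rewrite mxE.
  exact: in_cone_const.
rewrite vmax_restr_upset // vmin_restr_upset // => E.
by apply/eqP; rewrite subr_eq addrAC eq_sym subr_eq addrC E addrC.
Qed.

Lemma modular_npos_telescope I f s x : 0 \in I ->
  comonotonically_modular I f -> f 0 = 0 ->
  in_box I x -> in_cone s x -> (forall i, x ord0 i <= 0) ->
  f x = \sum_(k < n) (f (x ord0 (s k) *: ind R (~: upset s k.+1))
                      - f (x ord0 (s k) *: ind R (~: upset s k))).
Proof.
move=> I0 fm f0 xI sx x0.
pose g k := f (restr (~: upset s k) x).
have -> : f x = \sum_(k < n) (g k.+1 - g k).
  rewrite -(big_mkord predT (fun k => g k.+1 - g k)) telescope_sumr //.
  by rewrite /g upset0 upset_ge finset.setCT finset.setC0 restr0 restrT f0 subr0.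
apply: eq_bigr => k _; rewrite !scale_ind /g.
have xkI : x ord0 (s k) \in I by move/forallP : xI.
have /fm : comonotonic I (restr (~: upset s k) x)
    (restr (~: upset s k.+1) (const_mx (x ord0 (s k)))).
  exists s; rewrite !in_box_restr ?in_box_const ?in_cone_restr_upsetC //.
    by move=> i; rewrite mxE.
  exact: in_cone_const.
rewrite vmax_restr_upsetC // vmin_restr_upsetC // => E.
by apply/eqP; rewrite subr_eq addrAC eq_sym subr_eq addrC E.
Qed.

Definition sign_homogeneous I f :=
  forall c S, c \in I ->
    f (c *: ind R S) = Num.sg c * c * f (Num.sg c *: ind R S).

Lemma modular_nneg_choquet I f x : 0 \in I ->
  comonotonically_modular I f -> f 0 = 0 -> sign_homogeneous I f ->
  in_box I x -> (forall i, 0 <= x ord0 i) ->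
  f x = choquet (fun S => f (ind R S)) x.
Proof.
move=> I0 fm f0 fh xI x0; have [s sx] := in_cone_exists x.
rewrite (choquetE _ sx) (modular_nneg_telescope I0 fm f0 xI sx x0).
apply: eq_bigr => k _.
have xkI : x ord0 (s k) \in I by move/forallP : xI.
(* A zero coordinate is set apart, its sign not being 1; both terms then vanish. *)
have := x0 (s k); rewrite le_eqVlt => /predU1P[<-|xk].
  by rewrite !scale0r subrr mul0r.
by rewrite !(fh _ _ xkI) gtr0_sg // !scale1r mul1r mulrBr.
Qed.

Lemma modular_npos_choquet I f x : 0 \in I ->
  comonotonically_modular I f -> f 0 = 0 -> sign_homogeneous I f ->
  (forall S, f (ind R (~: S)) = f (ind R [set: 'I_n]) + f (- ind R S)) ->
  in_box I x -> (forall i, x ord0 i <= 0) ->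
  f x = choquet (fun S => f (ind R S)) x.
Proof.
move=> I0 fm f0 fh fC xI x0; have [s sx] := in_cone_exists x.
rewrite (choquetE _ sx) (modular_npos_telescope I0 fm f0 xI sx x0).
apply: eq_bigr => k _.
have xkI : x ord0 (s k) \in I by move/forallP : xI.
have := x0 (s k); rewrite le_eqVlt => /predU1P[->|xk].
  by rewrite !scale0r subrr mul0r.
(* This is condition (iii) for the complement of the upset; the constant [f 1] cancels in the
   differences of [v]. *)
have fU j : f (ind R (upset s j)) =
    f (ind R [set: 'I_n]) + f (- ind R (~: upset s j)).
  by rewrite -fC finset.setCK.
rewrite !(fh _ _ xkI) ltr0_sg // !scaleN1r !fU.
by rewrite opprD addrACA subrr add0r mulN1r -mulrBr mulNr -mulrN opprB.
Qed.

End Choquet.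

Theorem theorem10 (R : realType) (n : nat) (I : interval R)
    (f : 'rV[R]_n -> R) :
  (1 <= n)%N ->
  (0 < lebesgue_measure [set` I])%E ->
  ({subset `[0, 1] <= I} /\ {subset I <= `[0, +oo[}) \/
    {subset `[-1, 1] <= I} ->
  is_signed_choquet I f <->
  [/\ comonotonically_modular I f,
      f 0 = 0 /\
      (forall (x : R) (S : {set 'I_n}), x \in I ->
         f (x *: ind R S) = Num.sg x * x * f (Num.sg x *: ind R S))
    & {subset `[-1, 1] <= I} ->
      forall S : {set 'I_n},
        f (ind R (~: S)) = f (ind R [set: 'I_n]) + f (- ind R S)].
Proof.
move=> _ _ HI.
have I01 : {subset `[0, 1] <= I}.
  case: HI => [[]//|HI] x; rewrite in_itv /= => /andP[x0 x1].
  by apply: HI; rewrite in_itv /= x1 andbT (le_trans _ x0) ?lerN10.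
have I0 : 0 \in I by apply: I01; rewrite in_itv /= lexx ler01.
have I1 : 1 \in I by apply: I01; rewrite in_itv /= lexx ler01.
have N11 : -1 <= 1 :> R by rewrite (le_trans (lerN10 R)) ?ler01.
have box_ind (c : R) S : c \in I -> in_box I (c *: ind R S : 'rV[R]_n).
  by move=> cI; rewrite scale_ind in_box_restr ?in_box_const.
have box0 : in_box I (0 : 'rV[R]_n) by exact: in_box_const.
(* A negative [c] rules out an interval inside the nonnegative reals, so -1 belongs to [I]. *)
have sgI (c : R) : c \in I -> Num.sg c \in I.
  move=> cI; case: sgrP => // c0.
  case: HI => [[_ /(_ _ cI)]|]; last by apply; rewrite in_itv /= lexx.
  by rewrite in_itv /= andbT leNgt c0.
split=> [[v [_ fv]]|[fm [f0 fh] fC]].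
  split=> [x y [s [/andP[xI sx] /andP[yI sy]]]||H S].
  - rewrite !fv ?in_box_vmin ?in_box_vmax //; exact: choquet_modular sx sy.
  - split=> [|c S cI]; first by rewrite fv // choquet0.
    by rewrite !fv ?box_ind ?sgI // choquet_sgr.
  - have IN1 : -1 \in I by apply: H; rewrite in_itv /= lexx.
    have boxI T : in_box I (ind R T : 'rV[R]_n) by rewrite -[ind _ _]scale1r box_ind.
    by rewrite !fv ?choquet_indC // -scaleN1r box_ind.
(* The choice is forced, since [C_v] takes the value [v S] at [1_S], which lies in the box. *)
exists (fun S => f (ind R S)); split=> [|x xI].
  by rewrite /signed_capacity -[ind _ _]scale1r scale_ind restr0.
have [s sx] := in_cone_exists x.
(* The zero tuple is comonotonic with [x], so [f] and [C_v] split alike into the parts of [x] below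
   and above 0. *)
have s0 := @in_cone0 R n s.
have := choquet_modular (fun S => f (ind R S)) sx s0.
rewrite choquet0 addr0 => ->.
have /fm : comonotonic I x 0 by exists s; rewrite xI sx box0 s0.
rewrite f0 addr0 => ->; congr (_ + _).
  have boxm : in_box I (vmin x 0) by rewrite in_box_vmin.
  have xm i : vmin x 0 ord0 i <= 0 by rewrite !mxE ge_min lexx orbT.
  (* Condition (iii) is available only if [I] contains [-1, 1]; otherwise the negative part of [x]
     is zero. *)
  case: HI => [[_ Ipos]|HI]; last exact: modular_npos_choquet (fC HI) boxm xm.
  suff -> : vmin x 0 = 0 by rewrite f0 choquet0.
  apply/rowP => i; rewrite !mxE (min_idPr _) //.
  by have /forallP/(_ i)/Ipos := xI; rewrite in_itv /= andbT.
apply: (modular_nneg_choquet I0 fm) => //; first by rewrite in_box_vmax.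
by move=> i; rewrite !mxE le_max lexx orbT.
Qed.
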